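(* Every plane $\Pi$ is a Pasch space, and for every point $A\in\Pi$ the boundary at infinity $\partial(\Pi,A)$, with its natural relation of betweenness, is a circle.
   Context: A betweenness relation on a set $\Pi$ is a ternary relation ''$C$ is between $A$ and $B$'' such that, writing $s[A,B]$ for the set of all points between $A$ and $B$: (a) each point is between itself and any point of $\Pi$; (b) if $A$ is between $B$ and $C$, then $A$ is between $C$ and $B$; (c) if $C\in s[A,B]$, then $s[A,B]=s[A,C]\cup s[C,B]$ and $s[A,C]\cap s[C,B]=s[C,C]=\{C\}$. A closed line segment is a set of the form $s[A,B]$; its interior is $s(A,B)=s[A,B]\setminus\{A,B\}$. A subset $S$ is convex if $s[A,B]\subset S$ for all $A,B\in S$. A closed line segment is connected if, whenever it is expressed as a union of two disjoint non-empty convex subsets, precisely one of them is a closed line segment. A line is a set $l$ with a betweenness relation, consisting of at least two points, such that for every $A\in l$ the complement $l\setminus\{A\}$ is the union of two disjoint non-empty convex sets $c_1,c_2$ with $A\in s[B,C]$ whenever $B\in c_1$, $C\in c_2$. A line in $\Pi$ is a convex subset that is a line with the inherited betweenness. A circle is a set $c$ with a betweenness relation such that: $c$ contains at least three points; each $A\in c$ has an antipodal point $a(A)$ such that $s[A,a(A)]$ contains exactly two points; $s[A,B]$ is connected if $A$ is not antipodal to $B$; for each $A\in c$ the complement $c\setminus\{A,a(A)\}$ is the union of two disjoint non-empty convex sets that are lines with the inherited betweenness. A ray emanating from $A$ is a convex set $r$ such that: $A\in r$ but $A$ is not between any two other points of $r$; every three points of $r$ are contained in a closed line segment which is a subset of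 $r$; $r$ is not equal to any closed line segment. It is maximal if it is not a proper subset of another ray emanating from $A$, and connected if the closed line segments contained in it are connected. A space with maximal rays is a set with betweenness such that (1) if $s[A,B]$ and $s[A,C]$ have a common interior point, then one of them is contained in the other; (2) if $A\neq B$ and $s[A,B]$ is connected, then there is a connected $s[C,D]$ with $s[A,B]\subset s(C,D)$. If all closed line segments are connected, every $s[A,B]$ with $A\neq B$ is contained in a largest line in $\Pi$, denoted $l(A,B)$. A plane is a space $\Pi$ with maximal rays such that: $\Pi$ contains at least two points; for each pair of different points $A,B$ the segment $s[A,B]$ is connected and $\Pi\setminus l(A,B)$ is the union of two disjoint non-empty convex sets $h_1,h_2$ such that $s[C,D]$ intersects $l(A,B)$ at exactly one point whenever $C\in h_1$ and $D\in h_2$. Two maximal rays $r_1,r_2$ emanating from the same point $A$ are antipodal if there are $B\in r_1$, $C\in r_2$ with $A\in s(B,C)$. The boundary at infinity $\partial(\Pi,A)$ is the set of connected maximal rays emanating from $A$. A Pasch space is a space $\Pi$ with maximal rays satisfying the Pasch Condition: for every $A\in\Pi$ and every subset $\{r_1,r_2,r_3\}$ of $\partial(\Pi,A)$ disjoint from the set of its antipodal rays, and all points $B,C\in r_1\setminus\{A\}$ and $D\in r_3\setminus\{A\}$, if $r_2$ intersects $s[B,D]$ then $r_2$ intersects $s[C,D]$. The natural betweenness on $\partial(\Pi,A)$: if $r_1,r_2$ are antipodal or equal, $s[r_1,r_2]=\{r_1,r_2\}$; otherwise $r_3\in s[r_1,r_2]$ iff for every $B\in r_1$ and $C\in r_2$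 the ray $r_3$ intersects $s[B,C]$. *)

(* Defs.v *)
From mathcomp Require Import all_boot.
From mathcomp Require Import boolp classical_sets.

Set Implicit Arguments.
Unset Strict Implicit.
Unset Printing Implicit Defensive.

Local Open Scope classical_set_scope.

(* A set of points of T with a ternary relation; the betweenness axioms are the
   separate predicate [betweenness].  [btw X C A B] reads "C is between A and B";
   its values outside [pts X] are irrelevant, since every definition below
   quantifies over points of X and uses the relation only through [seg]. *)
Record bspace (T : Type) := BSpace {
  pts : set T;
  btw : T -> T -> T -> Prop
}.

Definition seg T (X : bspace T) (A B : T) : set T :=
  [set C | pts X C /\ btw X C A B].

Definition seg_interior T (X : bspace T) (A B : T) : set T :=
  seg X A B `\` [set A; B].

Definition betweenness T (X : bspace T) : Prop :=
  [/\ forall A B, pts X A -> pts X B -> seg X A B A,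
      forall A B C, pts X A -> pts X B -> pts X C ->
        seg X B C A -> seg X C B A
    & forall A B C, pts X A -> pts X B -> pts X C -> seg X A B C ->
        [/\ seg X A B = seg X A C `|` seg X C B,
            seg X A C `&` seg X C B = seg X C C
          & seg X C C = [set C]]].

(* Degenerate segments seg X A A are included. *)
Definition closed_segment T (X : bspace T) (S : set T) : Prop :=
  exists A B, [/\ pts X A, pts X B & S = seg X A B].

Definition convex T (X : bspace T) (S : set T) : Prop :=
  S `<=` pts X /\ forall A B, S A -> S B -> seg X A B `<=` S.

Definition convex_split T (X : bspace T) (S c1 c2 : set T) : Prop :=
  [/\ S = c1 `|` c2, c1 `&` c2 = set0,
      c1 !=set0 /\ c2 !=set0 & convex X c1 /\ convex X c2].

Definition connected_segment T (X : bspace T) (S : set T) : Prop :=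
  closed_segment X S /\
  forall P Q, convex_split X S P Q ->
    (closed_segment X P /\ ~ closed_segment X Q) \/
    (~ closed_segment X P /\ closed_segment X Q).

Definition inherited T (X : bspace T) (S : set T) : bspace T :=
  BSpace S (btw X).

Definition at_least_two T (S : set T) : Prop :=
  exists A B, [/\ S A, S B & A <> B].

Definition at_least_three T (S : set T) : Prop :=
  exists A B C, [/\ S A, S B & S C] /\ [/\ A <> B, A <> C & B <> C].

Definition exactly_two T (S : set T) : Prop :=
  exists A B, A <> B /\ S = [set A; B].

Definition line T (l : bspace T) : Prop :=
  [/\ betweenness l, at_least_two (pts l)
    & forall A, pts l A -> exists c1 c2,
        convex_split l (pts l `\ A) c1 c2 /\
        forall B C, c1 B -> c2 C -> seg l B C A].

Definition line_in T (X : bspace T) (l : set T) : Prop :=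
  convex X l /\ line (inherited X l).

Definition circle T (c : bspace T) : Prop :=
  [/\ betweenness c, at_least_three (pts c)
    & exists a : T -> T,
      [/\ forall A, pts c A -> pts c (a A) /\ exactly_two (seg c A (a A)),
          forall A B, pts c A -> pts c B -> B <> a A ->
            connected_segment c (seg c A B)
        & forall A, pts c A -> exists c1 c2,
            [/\ convex_split c (pts c `\` [set A; a A]) c1 c2,
                line (inherited c c1) & line (inherited c c2)]]].

Definition ray T (X : bspace T) (A : T) (r : set T) : Prop :=
  [/\ convex X r,
      r A /\ (forall B C, r B -> r C -> B <> A -> C <> A -> ~ seg X B C A),
      forall B C D, r B -> r C -> r D ->
        exists S, [/\ closed_segment X S, S `<=` r & [/\ S B, S C & S D]]
    & ~ closed_segment X r].

Definition maximal_ray T (X : bspace T) (A : T) (r : set T) : Prop :=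
  ray X A r /\ forall r', ray X A r' -> ~ r `<` r'.

Definition connected_ray T (X : bspace T) (r : set T) : Prop :=
  forall S, closed_segment X S -> S `<=` r -> connected_segment X S.

Definition maximal_ray_space T (X : bspace T) : Prop :=
  [/\ betweenness X,
      forall A B C, pts X A -> pts X B -> pts X C ->
        seg_interior X A B `&` seg_interior X A C !=set0 ->
        seg X A B `<=` seg X A C \/ seg X A C `<=` seg X A B
    & forall A B, pts X A -> pts X B -> A <> B ->
        connected_segment X (seg X A B) ->
        exists C D, [/\ pts X C, pts X D, connected_segment X (seg X C D)
                      & seg X A B `<=` seg_interior X C D]].

(* [largest_line X A B l] says that l is the line l(A,B). *)
Definition largest_line T (X : bspace T) (A B : T) (l : set T) : Prop :=
  [/\ line_in X l, seg X A B `<=` l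
    & forall l', line_in X l' -> seg X A B `<=` l' -> l' `<=` l].

Definition plane T (X : bspace T) : Prop :=
  [/\ maximal_ray_space X, at_least_two (pts X)
    & forall A B, pts X A -> pts X B -> A <> B ->
        connected_segment X (seg X A B) /\
        exists l, largest_line X A B l /\
          exists h1 h2, convex_split X (pts X `\` l) h1 h2 /\
            forall C D, h1 C -> h2 D -> exists P, seg X C D `&` l = [set P]].

Definition antipodal_rays T (X : bspace T) (A : T) (r1 r2 : set T) : Prop :=
  [/\ maximal_ray X A r1, maximal_ray X A r2
    & exists B C, [/\ r1 B, r2 C & seg_interior X B C A]].

Definition boundary T (X : bspace T) (A : T) : set (set T) :=
  [set r | maximal_ray X A r /\ connected_ray X r].

Definition boundary_btw T (X : bspace T) (A : T) (r3 r1 r2 : set T) : Prop :=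
  let degenerate := antipodal_rays X A r1 r2 \/ r1 = r2 in
  (degenerate -> r3 = r1 \/ r3 = r2) /\
  (~ degenerate -> forall B C, r1 B -> r2 C -> r3 `&` seg X B C !=set0).

Definition boundary_space T (X : bspace T) (A : T) : bspace (set T) :=
  BSpace (boundary X A) (boundary_btw X A).

Definition antipodal_set T (X : bspace T) (A : T) (R : set (set T)) :
    set (set T) :=
  [set r | exists2 r', R r' & antipodal_rays X A r' r].

Definition pasch_condition T (X : bspace T) : Prop :=
  forall A, pts X A -> forall r1 r2 r3 : set T,
    [set r1; r2; r3] `<=` boundary X A ->
    [set r1; r2; r3] `&` antipodal_set X A [set r1; r2; r3] = set0 ->
    forall B C D, (r1 `\ A) B -> (r1 `\ A) C -> (r3 `\ A) D ->
      r2 `&` seg X B D !=set0 -> r2 `&` seg X C D !=set0.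

Definition pasch_space T (X : bspace T) : Prop :=
  maximal_ray_space X /\ pasch_condition X.

(* Main.v *)
(* The separation axiom makes a plane an ordered incidence plane: l(A,B) is the
   set of points collinear with A and B, the maximal rays from A are the
   half-lines, and separation gives the crossbar theorem, which is the Pasch
   condition.  By the crossbar theorem X |-> ray AX carries [B,C] onto the
   segment of rays between AB and AC whenever A, B, C are not collinear, so
   betweenness and connectedness transfer from Pi to the boundary.  Removing a
   ray and its opposite leaves the rays pointing into the two half-planes of
   their common line, and each such set of rays is cut at any of its elements t
   by the line carrying t. *)
From mathcomp Require Import all_boot.
From mathcomp Require Import boolp classical_sets.
Require Import Defs.

(** * Splits of a singleton and inherited betweenness *)

Section Spaces.

Set Implicit Arguments.
Unset Strict Implicit.

Local Open Scope classical_set_scope.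

Variables (U : Type) (Y : bspace U).

Lemma convex_split_set1 x P Q : ~ convex_split Y [set x] P Q.
Proof.
case=> e dis [[y hy] [z hz]] _.
have /= ey : [set x] y by rewrite e; left.
have /= ez : [set x] z by rewrite e; right.
have : (P `&` Q) y by split=> //; rewrite ey -ez.
by rewrite dis.
Qed.

Lemma inherited_seg S x y : convex Y S -> S x -> S y ->
  seg (inherited Y S) x y = seg Y x y.
Proof.
move=> [sub cv] hx hy; apply/seteqP; split=> z; case=> hz hb; split=> //.
  exact: sub.
by apply: (cv x y).
Qed.

Lemma inherited_betweenness S :
  betweenness Y -> convex Y S -> betweenness (inherited Y S).
Proof.
move=> [r s c] cS; have [sub cv] := cS.
split=> [x y hx hy|x y z hx hy hz|x y z hx hy hz].
- by rewrite inherited_seg //; apply: r; exact: sub.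
- by rewrite !inherited_seg //; apply: s; exact: sub.
- by rewrite !inherited_seg //; apply: c; exact: sub.
Qed.

End Spaces.

(** * Calculus of betweenness *)

Section Plane.

Set Implicit Arguments.
Unset Strict Implicit.
Local Open Scope classical_set_scope.

Variables (T : Type) (X : bspace T).
Hypothesis hX : betweenness X.

(* The middle argument is the point in between, unlike in [btw]. *)
Definition bt A B C : Prop := [/\ pts X A, pts X C & seg X A C B].

Lemma bt_pts A B C : bt A B C -> [/\ pts X A, pts X B & pts X C].
Proof. by case=> hA hC []. Qed.

Lemma bt_sym A B C : bt A B C -> bt C B A.
Proof.
move=> h; have [hA hB hC] := bt_pts h.
by case: h => _ _ h; split=> //; case: hX => _ s _; exact: s.
Qed.

Lemma bt_l A B : pts X A -> pts X B -> bt A A B.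
Proof. by move=> hA hB; split=> //; case: hX => s _ _; exact: s. Qed.

Lemma bt_r A B : pts X A -> pts X B -> bt A B B.
Proof. by move=> hA hB; apply/bt_sym/bt_l. Qed.

Lemma bt_id A B : bt A B A -> B = A.
Proof.
move=> h; have [hA hB _] := bt_pts h; case: h => _ _ h.
case: hX => r _ c; have [_ _ e] := c A A A hA hA hA (r A A hA hA).
by move: h; rewrite e.
Qed.

Lemma bt_split A B C D : bt A C B -> bt A D B -> bt A D C \/ bt C D B.
Proof.
move=> h [_ _ hD]; have [hA hC hB] := bt_pts h; case: h => _ _ h.
case: hX => _ _ c; have [e _ _] := c A B C hA hB hC h.
by move: hD; rewrite e => -[?|?]; [left|right].
Qed.

Lemma bt_widen A B C D : bt A C B -> bt A D C -> bt A D B.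
Proof.
move=> h [_ _ hD]; have [hA hC hB] := bt_pts h; case: h => _ _ h.
case: hX => _ _ c; have [e _ _] := c A B C hA hB hC h.
by split=> //; rewrite e; left.
Qed.

Lemma bt_meet A B C D : bt A C B -> bt A D C -> bt C D B -> D = C.
Proof.
move=> h [_ _ h1] [_ _ h2]; have [hA hC hB] := bt_pts h; case: h => _ _ h.
case: hX => _ _ c; have [_ e e'] := c A B C hA hB hC h.
have : (seg X A C `&` seg X C B) D by [].
by rewrite e e'.
Qed.

Lemma bt_swap A B C : bt A B C -> bt A C B -> B = C.
Proof.
move=> h1 h2; have [_ hB hC] := bt_pts h1.
by apply: (bt_meet h2 h1); exact: bt_r.
Qed.

Lemma bt_mid A B C D : bt A C B -> bt A D C -> bt D C B.
Proof.
move=> h1 h2; have [hA hC hB] := bt_pts h1; have [_ hD _] := bt_pts h2.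
have [h|//] := bt_split (bt_widen h1 h2) h1.
by rewrite (bt_swap h2 h); exact: bt_l.
Qed.

(** This is the convexity of segments. [bt_split] decides which of C and D is nearer to A, and the
    two cases are mirror images. *)
Lemma bt_narrow A B C D E : bt A C B -> bt A D B -> bt C E D -> bt A E B.
Proof.
have main C' D' : bt A C' B -> bt A D' C' -> bt D' E C' -> bt A E B.
  move=> h1 h2 h3; apply: (bt_widen h1).
  by apply/bt_sym; apply: (bt_widen (bt_sym h2)); exact: bt_sym.
move=> h1 h2 h3; have [h|h] := bt_split h1 h2.
  exact: main h1 h (bt_sym h3).
apply: main h2 _ h3.
by apply/bt_sym; apply: (bt_mid (bt_sym h1)); exact: bt_sym.
Qed.

(** * Collinearity and the lines of a plane *)

Definition col A B C : Prop := [\/ bt A B C, bt B C A | bt C A B].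

Definition ln A B : set T := [set C | pts X C /\ col A B C].

Lemma col_rot A B C : col A B C -> col B C A.
Proof. by case=> h; [apply: Or33|apply: Or31|apply: Or32]. Qed.

Lemma col_swap A B C : col A B C -> col B A C.
Proof.
by case=> h; [apply: Or33|apply: Or32|apply: Or31]; exact: bt_sym.
Qed.

Lemma col_pts A B C : col A B C -> [/\ pts X A, pts X B & pts X C].
Proof. by case=> /bt_pts[]. Qed.

Lemma col_l A B : pts X A -> pts X B -> col A B A.
Proof. by move=> hA hB; apply: Or32; exact: bt_r. Qed.

Lemma lnE A B C : ln A B C <-> col A B C.
Proof. by split=> [[]|h] //; split=> //; case: (col_pts h). Qed.

Lemma ln_sym A B : ln A B = ln B A.
Proof.
by apply/seteqP; split=> C /lnE h; apply/lnE; exact: col_swap.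
Qed.

Lemma ln_l A B : pts X A -> pts X B -> ln A B A.
Proof. by move=> hA hB; apply/lnE; exact: col_l. Qed.

Lemma ln_r A B : pts X A -> pts X B -> ln A B B.
Proof. by move=> hA hB; rewrite ln_sym; exact: ln_l. Qed.

Hypothesis hP : plane X.

(** The point D is interior to both segments, so by the nesting axiom of maximal rays one segment
    contains the other, and with it the other's far end. *)
Lemma bt_fork A B C D : D <> A -> D <> B -> D <> C ->
  bt A D B -> bt A D C -> bt A B C \/ bt A C B.
Proof.
move=> dA dB dC [hA hB h1] [_ hC h2].
have [[_ nest _] _ _] := hP.
have {nest} := nest A B C hA hB hC; case.
- by exists D; split; split=> // -[].
- by move=> s; left; split=> //; apply: s; case: (bt_r hA hB).
- by move=> s; right; split=> //; apply: s; case: (bt_r hA hC).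
Qed.

(** Removing A leaves two convex sides. If B and C lie on different sides, A is between them. *)
Lemma line_col L A B C : line_in X L -> L A -> L B -> L C -> col A B C.
Proof.
case=> -[Lp Lc] [_ _ sp] hA hB hC.
have [pA pB pC] : [/\ pts X A, pts X B & pts X C] by split; exact: Lp.
have [<-|AB] := pselect (A = B); first by apply: Or31; exact: bt_l.
have [<-|nAC] := pselect (A = C); first exact: col_l.
have [c1 [c2 [[e dis [[D1 hD1] [D2 hD2]] _] opp]]] := sp A hA.
have sideE E : L E -> A <> E -> c1 E \/ c2 E.
  by move=> hE AE; have : (L `\ A) E; [split=> // /esym|rewrite e].
have subL E : c1 E \/ c2 E -> L E /\ E <> A.
  by move=> h; have : (L `\ A) E; [rewrite e|case].
have oppbt E F : c1 E -> c2 F -> bt E A F.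
  move=> h1 h2; have [_ h] := opp _ _ h1 h2.
  split; [| |split]; rewrite //=; try exact: Lp.
  - by apply: Lp; have [] := subL E (or_introl h1).
  - by apply: Lp; have [] := subL F (or_intror h2).
(* When B and C lie on one side, any D on the other side has A between it and both of them. Then A
   is interior to [D,B] and [D,C], and [bt_fork] nests these. *)
have same D : D <> A -> bt D A B -> bt D A C -> col A B C.
  move=> DA h1 h2.
  have [h|h] := bt_fork (nesym DA) AB nAC h1 h2.
    by apply: Or31; exact: bt_mid h h1.
  by apply: Or32; apply: bt_sym; exact: bt_mid h h2.
have [hB1|hB2] := sideE B hB AB; have [hC1|hC2] := sideE C hC nAC.
- apply: (same D2); first by have [] := subL D2 (or_intror hD2).
    exact/bt_sym/oppbt.
  exact/bt_sym/oppbt.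
- by apply: Or33; apply: bt_sym; exact: oppbt.
- by apply: Or33; exact: oppbt.
- apply: (same D1); [|exact: oppbt|exact: oppbt].
  by have [] := subL D1 (or_introl hD1).
Qed.

(** A line has only collinear triples by [line_col], which gives one inclusion. Conversely, a point
    C that prolongs [A,B] spans with A or B a longer segment; the line through that segment contains
    [A,B] and is absorbed by the largest one. *)
Lemma largest_lineE A B l : pts X A -> pts X B -> A <> B ->
  largest_line X A B l -> l = ln A B.
Proof.
move=> hA hB AB [lin sAB big].
have [lA lB] : l A /\ l B.
  by split; apply: sAB; [case: (bt_l hA hB)|case: (bt_r hA hB)].
have sub C D : pts X C -> pts X D -> C <> D ->
    seg X A B `<=` seg X C D -> seg X C D `<=` l.
  move=> hC hD CD s; have [_ _ pl] := hP.
  have [_ [m [[mlin sCD _] _]]] := pl C D hC hD CD.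
  by apply: (subset_trans sCD); apply: big => //; exact: (subset_trans s).
apply/seteqP; split=> C.
  by move=> lC; apply/lnE; exact: (line_col lin).
case=> hC [] h.
- apply: (sub A C) => //; last by case: (bt_r hA hC).
    by move=> eAC; apply: AB; move: h; rewrite -eAC => /bt_id->.
  by move=> D sD; case: (bt_widen h (D := D)).
- by apply: sAB; case: (bt_sym h).
- apply: (sub C B) => //; last by case: (bt_l hC hB).
    by move=> CB; apply: AB; move: h; rewrite CB => /bt_id.
  move=> D sD; have [] // := @bt_sym B D C.
  by apply: bt_widen (bt_sym h) _; exact: bt_sym.
Qed.

Lemma ln_largest A B : pts X A -> pts X B -> A <> B ->
  largest_line X A B (ln A B).
Proof.
move=> hA hB AB; have [_ _ pl] := hP.
have [_ [l [hl _]]] := pl A B hA hB AB.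
by rewrite -(largest_lineE hA hB AB hl).
Qed.

Lemma ln_line A B : pts X A -> pts X B -> A <> B -> line_in X (ln A B).
Proof. by move=> hA hB AB; case: (ln_largest hA hB AB). Qed.

Lemma ln_bt A B C D E : pts X A -> pts X B -> A <> B ->
  ln A B C -> ln A B D -> bt C E D -> ln A B E.
Proof.
move=> hA hB AB hC hD [_ _ h].
by have [[_ cv] _] := ln_line hA hB AB; exact: (cv C D).
Qed.

(** Maximality of l(C,D) absorbs l(A,B), which is a line containing [C,D]; the reverse inclusion is
    [line_col] inside l(C,D). *)
Lemma ln_eq A B C D : pts X A -> pts X B -> A <> B -> C <> D ->
  ln A B C -> ln A B D -> ln C D = ln A B.
Proof.
move=> hA hB AB CD hC hD.
have [pC pD] : pts X C /\ pts X D by split; [case: hC|case: hD].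
have AB_CD : ln A B `<=` ln C D.
  have [_ _ big] := ln_largest pC pD CD.
  apply: big; first exact: ln_line.
  by move=> E sE; apply: (ln_bt hA hB AB hC hD).
apply/seteqP; split=> // E hE; apply/lnE.
by apply: (line_col (ln_line pC pD CD)) => //; apply: AB_CD;
  [exact: ln_l|exact: ln_r].
Qed.

(** Both A and D lie on l(B,C), so A, B, D are collinear; the two orders other than the desired one
    force B = C or A = B. *)
Lemma bt_outer A B C D : B <> C -> bt A B C -> bt B C D -> bt A B D.
Proof.
move=> BC h1 h2.
have [hA hB hC] := bt_pts h1; have [_ _ hD] := bt_pts h2.
have [AB|AB] := pselect (A = B); first by rewrite AB; exact: bt_l.
have : col A B D.
  apply: (line_col (ln_line hB hC BC)); first by apply/lnE; apply: Or33.
    exact: ln_l.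
  by apply/lnE; apply: Or31.
case=> // h; exfalso.
- by apply/BC/(bt_swap h1)/bt_sym/(bt_widen h h2).
- have [h3|h3] := bt_split h2 (bt_sym h).
    by apply/AB/esym/(bt_swap (bt_sym h1))/bt_sym.
  by apply/BC/(bt_swap h1)/(bt_mid (bt_sym h2))/bt_sym.
Qed.

(** The second axiom of maximal rays puts [A,B] in the interior of some [C,D]. Seen from A, the
    point B lies towards C or towards D, and that end prolongs the segment. *)
Lemma bt_extend A B : pts X A -> pts X B -> A <> B ->
  exists2 C, bt A B C & C <> B.
Proof.
move=> hA hB AB; have [[_ _ ext] _ pl] := hP.
have [con _] := pl A B hA hB AB.
have [C [D [hC hD _ s]]] := ext A B hA hB AB con.
have [[_ h1] _] : seg_interior X C D A by apply: s; case: (bt_l hA hB).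
have [[_ h2] nB] : seg_interior X C D B by apply: s; case: (bt_r hA hB).
have [h|h] : bt C B A \/ bt A B D by apply: (@bt_split C D A B).
- by exists C; [exact: bt_sym|move=> e; apply: nB; left].
- by exists D => // e; apply: nB; right.
Qed.

(** * The two sides of a line *)

Definition same_side (l : set T) C D : Prop :=
  [/\ pts X C, pts X D & forall E, bt C E D -> ~ l E].

Lemma same_side_sym l C D : same_side l C D -> same_side l D C.
Proof. by case=> hC hD h; split=> // E /bt_sym /h. Qed.

Lemma same_side_off l C D : same_side l C D -> ~ l C /\ ~ l D.
Proof. by case=> hC hD h; split; apply: h; [exact: bt_l|exact: bt_r]. Qed.

(** A segment from one side to the other meets the line by the separation axiom, while convexity
    keeps a segment with both ends in one side off the line. Thus the sides are determined by
    segments alone, and [same_side] needs no choice of [h1] and [h2]. *)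
Lemma ln_sides A B : pts X A -> pts X B -> A <> B ->
  exists h1 h2, convex_split X (pts X `\` ln A B) h1 h2 /\
    forall C D, same_side (ln A B) C D <-> (h1 C /\ h1 D) \/ (h2 C /\ h2 D).
Proof.
move=> hA hB AB; have [_ _ pl] := hP.
have [_ [l [hl [h1 [h2 [sp cross]]]]]] := pl A B hA hB AB.
rewrite -(largest_lineE hA hB AB hl); exists h1, h2; split=> //.
have [e dis _ [[p1 c1] [p2 c2]]] := sp.
have off E : h1 E \/ h2 E -> ~ l E.
  by move=> h; have [] : (pts X `\` l) E by rewrite e.
have cut C D : h1 C -> h2 D -> ~ same_side l C D.
  move=> hC hD [pC pD h]; have [P eP] := cross C D hC hD.
  have [[? ?] lP] : (seg X C D `&` l) P by rewrite eP.
  by apply: (h P).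
move=> C D; split.
- move=> h; have [pC pD _] := h; have [lC lD] := same_side_off h.
  have hC : (h1 `|` h2) C by rewrite -e.
  have hD : (h1 `|` h2) D by rewrite -e.
  case: hC hD => hC [] hD; [by left| | |by right].
    by case: (cut C D).
  by case: (cut D C) => //; exact: same_side_sym.
- by move=> [[hC hD]|[hC hD]]; split; auto;
    move=> E [_ _ sE]; apply: off; [left; apply: (c1 C D)|right; apply: (c2 C D)].
Qed.

Lemma same_side_trans A B C D E : pts X A -> pts X B -> A <> B ->
  same_side (ln A B) C D -> same_side (ln A B) D E -> same_side (ln A B) C E.
Proof.
move=> hA hB AB; have [h1 [h2 [[_ dis _ _] sE]]] := ln_sides hA hB AB.
have ex F : h1 F -> h2 F -> False.
  by move=> a b; have : (h1 `&` h2) F by []; rewrite dis.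
by rewrite !sE => -[[? ?]|[? ?]] [[? ?]|[? ?]]; try (exfalso; exact: (ex D));
  [left|right].
Qed.

Lemma same_side_ln A B C D : pts X A -> pts X B -> A <> B ->
  pts X C -> pts X D -> ~ same_side (ln A B) C D ->
  exists2 E, ln A B E & bt C E D.
Proof.
move=> hA hB AB hC hD h; apply: contra_notP h => h; split=> // E hE lE.
by apply: h; exists E.
Qed.

(** * Half-lines and the crossbar theorem *)

Definition hl A B : set T := [set C | bt A C B \/ bt A B C].

Lemma hl_ln A B : hl A B `<=` ln A B.
Proof.
by move=> C [] h; apply/lnE; [apply/Or32/bt_sym|apply: Or31].
Qed.

Lemma hl_o A B : pts X A -> pts X B -> hl A B A.
Proof. by move=> hA hB; left; exact: bt_l. Qed.

Lemma hl_r A B : pts X A -> pts X B -> hl A B B.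
Proof. by move=> hA hB; left; exact: bt_r. Qed.

Lemma hl_pts A B C : hl A B C -> [/\ pts X A, pts X B & pts X C].
Proof. by case=> /bt_pts[]. Qed.

Lemma hl_total A B C D : A <> B -> hl A B C -> hl A B D -> hl A C D.
Proof.
move=> AB hC hD; have [hA _ pC] := hl_pts hC; have [_ _ pD] := hl_pts hD.
have [BC|BC] := pselect (B = C); first by rewrite -BC.
have [BD|BD] := pselect (B = D).
  by rewrite -BD; case: hC; [right|left].
case: hC hD => h1 [] h2.
- have [h|h] := bt_split h1 h2; first by left.
  by right; apply/bt_sym/(bt_mid (bt_sym h1))/bt_sym.
- by right; exact: bt_widen h2 h1.
- by left; exact: bt_widen h1 h2.
- by have [h|h] := bt_fork (nesym AB) BC BD h1 h2; [right|left].
Qed.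

(** Points of a half-line are comparable by [hl_total], so any of them other than the apex
    represents it. The apex itself does not: [hl A A] consists of all points when A is a point of
    the plane. *)
Lemma hl_eq A B C : A <> B -> A <> C -> hl A B C -> hl A C = hl A B.
Proof.
move=> AB nAC hC; have [hA hB _] := hl_pts hC; apply/seteqP; split=> D hD.
  by apply: (hl_total nAC) => //; apply: hl_total hC _ => //; exact: hl_r.
exact: hl_total hC hD.
Qed.

Lemma hl_between A B C D : A <> B -> hl A B C -> hl A B D -> bt C A D ->
  A = C \/ A = D.
Proof.
move=> AB hC hD h; have [hh|hh] := hl_total AB hC hD.
  by right; apply: bt_swap h (bt_sym hh).
by left; apply: bt_swap (bt_sym h) (bt_sym hh).
Qed.

Lemma ln_hl A B C : ln A B C -> hl A B C \/ bt B A C.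
Proof.
by move=> /lnE[] h; [left; right|left; left; exact: bt_sym|right; exact: bt_sym].
Qed.

Lemma hl_bt A B C D E : A <> B -> hl A B C -> hl A B D -> bt C E D -> hl A B E.
Proof.
have main C' D' : A <> B -> hl A B C' -> hl A B D' -> bt A C' D' ->
    bt C' E D' -> hl A B E.
  move=> AB hC hD h1 h2; have [hA _ pD] := hl_pts hD.
  have [nAD|nAD] := pselect (A = D').
    by move: h1 h2; rewrite -nAD => /bt_id-> /bt_id->; apply: hl_o => //;
      case: (hl_pts hC).
  rewrite -(hl_eq AB nAD hD); left.
  by apply/bt_sym/(bt_widen (bt_sym h1))/bt_sym.
move=> AB hC hD h; have [hh|hh] := hl_total AB hC hD.
  by apply: (main D C) => //; exact: bt_sym.
exact: (main C D).
Qed.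

(** A half-line that leaves a line at its apex never returns: a second common point E would make
    l(A,E) equal to l(O,U), which would then contain B. *)
Lemma hl_same_side O U A B C : pts X O -> pts X U -> O <> U ->
  ln O U A -> pts X B -> ~ ln O U B -> hl A B C -> A <> C ->
  same_side (ln O U) B C.
Proof.
move=> hO hU OU lA hB lB hC nAC; have [hA _ pC] := hl_pts hC.
split=> // E hE lE.
have AB : A <> B by move=> e; apply: lB; rewrite -e.
have hlE : hl A B E by apply: (hl_bt AB _ hC hE); exact: hl_r.
have [eAE|nAE] := pselect (A = E).
  by case: (@hl_between A B B C) => //; [exact: hl_r|rewrite eAE].
apply: lB; rewrite -(ln_eq hO hU OU nAE lA lE); apply: hl_ln.
by rewrite (hl_eq AB nAE hlE); exact: hl_r.
Qed.

(** The line l(A,E) separates B from D, and C is on the same side as B because it lies on the ray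
    AB. Hence l(A,E) also separates C from D, and [C,D] meets it. *)
Lemma crossbar A B C D E : ~ col A B D -> bt B E D -> hl A B C -> A <> C ->
  exists2 F, bt C F D & hl A E F.
Proof.
move=> ncol hE hC nAC.
have [hA hB pC] := hl_pts hC; have [_ pE hD] := bt_pts hE.
have AB : A <> B by move=> e; apply: ncol; rewrite e; apply/Or31/bt_l.
have AD : A <> D by move=> e; apply: ncol; rewrite e; apply/col_l.
have [eEB|EB] := pselect (E = B).
  by exists C; [exact: bt_l|rewrite eEB].
have [eED|ED] := pselect (E = D).
  by exists D; [exact: bt_r|rewrite eED; exact: hl_r].
have BD : B <> D by move=> e; apply: EB; move: hE; rewrite -e => /bt_id.
have lBD_E : ln B D E by apply/lnE/Or32/bt_sym.
have nA : ~ ln B D A by move=> /lnE /col_rot /col_rot.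
have AE : A <> E by move=> e; apply: nA; rewrite e.
have lB : ~ ln A E B.
  move=> lB; apply: nA; rewrite -(ln_eq hB hD BD EB) //; last exact: ln_l.
  by apply/lnE; move/lnE: lB => /col_rot.
have lD : ~ ln A E D.
  move=> lD; apply: nA; rewrite -(ln_eq hB hD BD ED) //; last exact: ln_r.
  by apply/lnE; move/lnE: lD => /col_rot.
have lA := ln_l hA pE.
have ssBC := hl_same_side hA pE AE lA hB lB hC nAC.
have [_ lC] := same_side_off ssBC.
have [F lF hF] : exists2 F, ln A E F & bt C F D.
  apply: same_side_ln => // ss.
  have [_ _ /(_ E hE)] := same_side_trans hA pE AE ssBC ss.
  by apply; exact: ln_r.
(* It remains to exclude that A lies between E and F. Both lie on the side of l(A,B) that contains
   D, since [B,D] and [C,D] leave that line at B and C. *)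
exists F => //; case: (ln_hl lF) => // EAF; exfalso.
have CF : C <> F by move=> e; apply: lC; rewrite e.
have mD : ~ ln A B D by move=> /lnE.
have mB := ln_r hA hB.
have mC : ln A B C by exact: hl_ln.
have hEF : same_side (ln A B) E F.
  apply: (@same_side_trans _ _ _ D) => //.
    apply: same_side_sym; apply: (hl_same_side hA hB AB mB) => //; last exact: nesym.
    by left.
  by apply: (hl_same_side hA hB AB mC) => //; left.
by have [_ _ /(_ A EAF)] := hEF; apply; exact: ln_l.
Qed.

(** * Maximal rays are half-lines *)

Lemma seg_bt A B C : pts X A -> pts X B -> seg X A B C <-> bt A C B.
Proof. by move=> hA hB; split=> [|[]]. Qed.

Lemma seg_id A : pts X A -> seg X A A = [set A].
Proof.
move=> hA; apply/seteqP; split=> C /=; first by move=> h; exact: bt_id.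
by move=> ->; case: (bt_l hA hA).
Qed.

(** Comparability yields a farthest point N of any three, and [A,N] contains them all. A half-line
    is no segment, because A could only be one of its ends and the other end can be passed. *)
Lemma hl_ray A B : pts X A -> pts X B -> A <> B -> ray X A (hl A B).
Proof.
move=> hA hB AB; split.
- split=> [C /hl_pts[] //|C D hC hD E hE]; apply: (hl_bt AB hC hD).
  by split=> //; [case: (hl_pts hC)|case: (hl_pts hD)].
- split=> [|C D hC hD CA DA h]; first exact: hl_o.
  have h' : bt C A D by split; [case: (hl_pts hC)|case: (hl_pts hD)|].
  by case: (hl_between AB hC hD h') => /esym.
- have max C D : hl A B C -> hl A B D ->
      exists2 M, hl A B M & bt A C M /\ bt A D M.
    move=> hC hD; have [_ _ pC] := hl_pts hC; have [_ _ pD] := hl_pts hD.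
    have [h|h] := hl_total AB hC hD.
      by exists C => //; split=> //; exact: bt_r.
    by exists D => //; split=> //; exact: bt_r.
  move=> C D E hC hD hE; have [M hM [CM DM]] := max C D hC hD.
  have [N hN [MN EN]] := max M E hM hE; have [_ _ pN] := hl_pts hN.
  exists (seg X A N); split; first by exists A, N.
    move=> F sF; apply: (hl_bt AB (C := A) (D := N)) => //.
    exact: hl_o.
  by split; apply/seg_bt => //; exact: bt_widen MN _.
- case=> C [D [hC hD e]].
  (* If the half-line ended at M, prolonging [A,M] beyond M by [bt_extend] would give a further
     point of it. *)
  have noA M : pts X M -> hl A B = seg X A M -> False.
    move=> hM eM.
    have hlM : hl A B M by rewrite eM; apply/seg_bt => //; exact: bt_r.
    have AM : A <> M.
      move=> eAM; have := hl_r hA hB.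
      by rewrite eM -eAM seg_id // => /esym.
    have [N AMN NM] := bt_extend hA hM AM.
    have : hl A B N by rewrite -(hl_eq AB AM hlM); right.
    by rewrite eM => /(seg_bt _ hA hM) /(bt_swap AMN) /esym.
  have hlC : hl A B C by rewrite e; apply/seg_bt => //; exact: bt_l.
  have hlD : hl A B D by rewrite e; apply/seg_bt => //; exact: bt_r.
  have [|eA|eA] := hl_between AB hlC hlD.
  + by apply/seg_bt => //; rewrite -e; exact: hl_o.
  + by apply: (noA D) => //; rewrite e eA.
  + apply: (noA C) => //; rewrite e eA; apply/seteqP.
    by split=> E /(seg_bt _) h; apply/seg_bt => //; apply/bt_sym/h.
Qed.

(** A ray has a second point B, since {A} is a closed segment. A segment inside r through A, B and
    any C must have A as an end, because A is not between other points of r; along it B and C are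
    comparable. *)
Lemma ray_sub_hl A r : ray X A r ->
  exists B, [/\ A <> B, pts X B, r B & r `<=` hl A B].
Proof.
case=> -[rp rc] [rA nb] three ncl; have hA := rp _ rA.
have [B [rB AB]] : exists B, r B /\ A <> B.
  apply: contra_notP ncl => h; exists A, A; split=> //; rewrite seg_id //.
  apply/seteqP; split=> [C rC|C ->] //=.
  by apply: contra_notP h => CA; exists C; split=> // /esym.
have hB := rp _ rB.
exists B; split=> // C rC.
have [_ [[D [E [hD hE ->]]] sr [sA sB sC]]] := three A B C rA rB rC.
have rD : r D by apply: sr; apply/seg_bt => //; exact: bt_l.
have rE : r E by apply: sr; apply/seg_bt => //; exact: bt_r.
have end_ F : seg X A F B -> seg X A F C -> pts X F -> hl A B C.
  move=> /(seg_bt _ hA) h1 /(seg_bt _ hA) h2 hF.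
  have [h|h] := bt_split (h1 hF) (h2 hF); first by left.
  by right; apply/bt_sym/(bt_mid (bt_sym (h1 hF)))/bt_sym.
have [eD|nD] := pselect (D = A); first by apply: (end_ E) => //; rewrite -eD.
have [eE|nE] := pselect (E = A); last by case: (nb D E).
move: sB sC => /(seg_bt _ hD hE) /bt_sym[_ _ sB] /(seg_bt _ hD hE) /bt_sym[_ _ sC].
by apply: (end_ D); rewrite -?eE.
Qed.

Lemma maximal_hl A r : maximal_ray X A r <->
  exists B, [/\ pts X A, pts X B, A <> B & r = hl A B].
Proof.
split=> [[ry mx]|[B [hA hB AB ->]]].
  have [B [AB hB rB s]] := ray_sub_hl ry.
  have hA : pts X A by have [[p _] [rA _] _ _] := ry; exact: p.
  exists B; split=> //; apply/seteqP; split=> //.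
  by apply: contra_notP (mx _ (hl_ray hA hB AB)).
split=> [|r' ry [s n]]; first exact: hl_ray.
have [C [nAC hC rC s']] := ray_sub_hl ry.
apply: n; have hlB : hl A C B by apply: s'; apply: s; exact: hl_r.
by rewrite (hl_eq nAC AB hlB).
Qed.

Lemma all_connected S : closed_segment X S -> connected_segment X S.
Proof.
case=> A [B [hA hB ->]]; have [AB|AB] := pselect (A = B); last first.
  by have [_ _ pl] := hP; have [] := pl A B hA hB AB.
rewrite -AB seg_id //; split; first by exists A, A; rewrite seg_id.
by move=> P Q sp; case: (convex_split_set1 sp).
Qed.

(** * The boundary at A: antipodal and degenerate pairs *)

Variable A : T.
Hypothesis hA : pts X A.

Local Notation bd := (boundary_space X A).

Lemma boundaryE r :
  boundary X A r <-> exists B, [/\ pts X B, A <> B & r = hl A B].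
Proof.
split=> [[/maximal_hl[B [_ ? ? ?]] _]|[B [hB AB ->]]]; first by exists B.
by split=> [|S cS _]; [apply/maximal_hl; exists B|exact: all_connected].
Qed.

Lemma antipodalE r1 r2 : antipodal_rays X A r1 r2 <->
  exists B C, [/\ A <> B, A <> C, bt B A C, r1 = hl A B & r2 = hl A C].
Proof.
split=> [|[B [C [AB nAC h -> ->]]]].
  case=> /maximal_hl[B' [_ hB' AB' ->]] /maximal_hl[C' [_ hC' AC' ->]].
  move=> [B [C [hB hC [s n]]]].
  have h : bt B A C by split; [case: (hl_pts hB)|case: (hl_pts hC)|].
  have AB : A <> B by move=> e; apply: n; left.
  have nAC : A <> C by move=> e; apply: n; right.
  by exists B, C; split=> //; [rewrite (hl_eq AB' AB hB)|rewrite (hl_eq AC' nAC hC)].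
have [hB _ hC] := bt_pts h.
split; [by apply/maximal_hl; exists B|by apply/maximal_hl; exists C|].
exists B, C; split; [exact: hl_r|exact: hl_r|split; first by case: h].
by case.
Qed.

Lemma antipodal_sym r1 r2 : antipodal_rays X A r1 r2 -> antipodal_rays X A r2 r1.
Proof.
move=> /antipodalE[B [C [? ? h ? ?]]]; apply/antipodalE.
by exists C, B; split=> //; exact: bt_sym.
Qed.

(** Turns the case distinction in [boundary_btw] into a question about points: the nondegenerate
    pairs of rays are those that span a triangle with A. *)
Lemma degenerateE B C : pts X B -> pts X C -> A <> B -> A <> C ->
  antipodal_rays X A (hl A B) (hl A C) \/ hl A B = hl A C <-> col A B C.
Proof.
move=> hB hC AB nAC; split=> [[|e]|/lnE /ln_hl[h|h]].
- move=> /antipodalE[B' [C' [AB' AC' h eB eC]]].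
  have [hB' _ hC'] := bt_pts h.
  have lnB : ln A B' B by apply: hl_ln; rewrite -eB; exact: hl_r.
  have lnC : ln A C' C by apply: hl_ln; rewrite -eC; exact: hl_r.
  have lnC' : ln A B' C' by apply/lnE/Or33/bt_sym.
  apply: (line_col (ln_line hA hB' AB')) => //; first exact: ln_l.
  by rewrite -(ln_eq hA hB' AB' AC') //; exact: ln_l.
- by apply/lnE/hl_ln; rewrite e; exact: hl_r.
- by right; rewrite (hl_eq AB nAC h).
- by left; apply/antipodalE; exists B, C.
Qed.

Lemma bt_hl B C D : A <> B -> bt B A C -> hl A B D -> bt D A C.
Proof.
move=> AB h [hD|hD]; first exact: bt_mid h (bt_sym hD).
by apply/bt_sym; apply: (bt_outer AB (bt_sym h)).
Qed.

(** Quantifying over all points of r gives an antipode map without choosing a point behind A;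
    [opposite_hl] shows that its value on a half-line is the half-line on the other side of A. *)
Definition opposite (r : set T) : set T :=
  [set C | pts X C /\ forall B, r B -> bt B A C].

Lemma opposite_hl B C : A <> B -> A <> C -> bt B A C ->
  opposite (hl A B) = hl A C.
Proof.
move=> AB nAC h; have [hB _ hC] := bt_pts h.
apply/seteqP; split=> D; last first.
  move=> hD; split=> [|B' hB']; first by case: (hl_pts hD).
  by apply/bt_sym; apply: (bt_hl nAC) hD; apply/bt_sym; exact: bt_hl hB'.
move=> [hD /(_ B (hl_r hA hB)) h'].
have [<-|AD] := pselect (A = D); first exact: hl_o.
have [h2|h2] := bt_fork AB nAC AD h h'.
  by right; exact: bt_mid h2 h.
by left; exact: bt_mid h2 h'.
Qed.

Lemma boundary_opposite r : boundary X A r ->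
  exists B C, [/\ A <> B, A <> C, bt B A C, r = hl A B & opposite r = hl A C].
Proof.
move=> /boundaryE[B [hB AB ->]].
have [C h CA] := bt_extend hB hA (nesym AB).
by exists B, C; split=> //; [exact: nesym|apply: opposite_hl => //; exact: nesym].
Qed.

Lemma antipodal_opposite r : boundary X A r ->
  antipodal_rays X A r (opposite r).
Proof.
move=> /boundary_opposite[B [C [? ? ? -> ->]]].
by apply/antipodalE; exists B, C.
Qed.

Lemma antipodal_boundary r1 r2 : antipodal_rays X A r1 r2 -> boundary X A r1.
Proof.
move=> /antipodalE[B [C [? _ /bt_pts[? _ _] ? _]]].
by apply/boundaryE; exists B.
Qed.

Lemma antipodal_eq r1 r2 : antipodal_rays X A r1 r2 -> r2 = opposite r1.
Proof.
by move=> /antipodalE[B [C [AB nAC h -> ->]]]; rewrite (opposite_hl AB nAC h).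
Qed.

Lemma antipodal_neq r1 r2 : antipodal_rays X A r1 r2 -> r1 <> r2.
Proof.
move=> /antipodalE[B [C [AB nAC h -> ->]]] e; have [hB _ hC] := bt_pts h.
have hlC : hl A B C by rewrite e; exact: hl_r.
by case: (hl_between AB (hl_r hA hB) hlC h).
Qed.

(** * Segments of rays and the Pasch condition *)

Lemma boundary_seg_degenerate r1 r2 : boundary X A r1 -> boundary X A r2 ->
  antipodal_rays X A r1 r2 \/ r1 = r2 -> seg bd r1 r2 = [set r1; r2].
Proof.
move=> h1 h2 deg; apply/seteqP; split=> r.
  by case=> _ [/(_ deg)].
by case=> ->; split=> //; split=> [_|/(_ deg) //]; [left|right].
Qed.

Lemma boundary_seg_refl r : boundary X A r -> seg bd r r = [set r].
Proof.
move=> hr; rewrite boundary_seg_degenerate //; last by right.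
by apply/seteqP; split=> s; [case|left].
Qed.

(** A ray between the two meets [B,C] itself, which gives one inclusion. For the other, a ray
    through a point of [B,C] has to meet [U,V] for all U and V on the two sides of the angle, which
    takes two applications of [crossbar]. *)
Lemma boundary_seg B C : ~ col A B C -> pts X B -> pts X C ->
  seg bd (hl A B) (hl A C) = hl A @` seg X B C.
Proof.
move=> ncol hB hC.
have AB : A <> B by move=> e; apply: ncol; rewrite e; apply/Or31/bt_l.
have nAC : A <> C by move=> e; apply: ncol; rewrite e; exact: col_l.
have ndeg := contra_not (proj1 (degenerateE hB hC AB nAC)) ncol.
have off D : bt B D C -> A <> D.
  by move=> h e; apply: ncol; rewrite e; apply: Or33; exact: bt_sym.
apply/seteqP; split=> r.
  case=> /boundaryE[D [hD AD ->]] [_ /(_ ndeg)].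
  move=> /(_ B C (hl_r hA hB) (hl_r hA hC)) [E [hE sE]].
  have AE : A <> E by apply: off.
  by exists E => //; exact: hl_eq.
move=> [D /(seg_bt _ hB hC) h <-]; have [_ hD _] := bt_pts h; have AD := off D h.
split; first by apply/boundaryE; exists D.
split=> // _ U V hU hV.
have [_ _ pU] := hl_pts hU; have [_ _ pV] := hl_pts hV.
(* If U or V is the apex, the apex is a common point. *)
have [eU|AU] := pselect (A = U).
  by exists A; split; [exact: hl_o|rewrite -eU; case: (bt_l hA pV)].
have [eV|AV] := pselect (A = V).
  by exists A; split; [exact: hl_o|rewrite -eV; case: (bt_r pU hA)].
(* The first crossbar replaces B by U, the second replaces C by V. *)
have [E hE DE] := crossbar ncol h hU AU.
have ncol' : ~ col A C U.
  move/(degenerateE hC pU nAC AU); rewrite (hl_eq AB AU hU) => d; apply: ndeg.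
  by case: d => [/antipodal_sym|]; [left|right].
have AE : A <> E.
  by move=> e; apply: ncol'; rewrite e; apply: Or33.
have [F hF EF] := crossbar ncol' (bt_sym hE) hV AV.
by exists F; split; [rewrite -(hl_eq AD AE DE)|case: (bt_sym hF)].
Qed.

(** If A, B, D are not collinear this is [crossbar]. Otherwise r1 = r3, as antipodal rays are
    excluded; then r2 meets [B,D] inside r1 away from A, so r2 = r1 and C is a common point. *)
Lemma pasch_at r1 r2 r3 B C D : boundary X A r1 -> boundary X A r2 ->
  boundary X A r3 -> ~ antipodal_rays X A r1 r3 ->
  (r1 `\ A) B -> (r1 `\ A) C -> (r3 `\ A) D ->
  r2 `&` seg X B D !=set0 -> r2 `&` seg X C D !=set0.
Proof.
move=> /boundaryE[B0 [_ AB0 ->]] /boundaryE[E0 [_ AE0 ->]].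
move=> /boundaryE[D0 [_ AD0 ->]] nanti [hB /nesym AB] [hC /nesym nAC].
move=> [hD /nesym AD] [E [hE sE]].
have [_ _ pB] := hl_pts hB; have [_ _ pC] := hl_pts hC.
have [_ _ pD] := hl_pts hD.
have BED : bt B E D by split.
rewrite -(hl_eq AB0 AB hB) in nanti hC *.
rewrite -(hl_eq AD0 AD hD) in nanti.
have [/(degenerateE pB pD AB AD)[//|e]|ncol] := pselect (col A B D).
  have hBE : hl A B E.
    by apply: (hl_bt AB) BED; [exact: hl_r|rewrite e; exact: hl_r].
  have AE : A <> E.
    move=> eA; rewrite -eA in BED.
    have hBD : hl A B D by rewrite e; exact: hl_r.
    by case: (hl_between AB (hl_r hA pB) hBD BED).
  exists C; split; last by case: (bt_l pC pD).
  by rewrite -(hl_eq AE0 AE hE) (hl_eq AB AE hBE).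
have AE : A <> E by move=> e; apply: ncol; rewrite e; apply/Or33/bt_sym.
have [F [_ _ sF] EF] := crossbar ncol BED hC nAC.
by exists F; split=> //; rewrite -(hl_eq AE0 AE hE).
Qed.

(** * Transfer of betweenness and connectedness from a transversal *)

Lemma boundary_seg_l r1 r2 : boundary X A r1 -> boundary X A r2 ->
  seg bd r1 r2 r1.
Proof.
move=> h1 h2; split=> //; split=> [_|_ B C hB hC]; first by left.
have sub r : boundary X A r -> r `<=` pts X.
  by move=> /boundaryE[D [_ _ ->]] E /hl_pts[].
exists B; split=> //.
by case: (bt_l (sub _ h1 _ hB) (sub _ h2 _ hC)).
Qed.

Lemma boundary_seg_sym r1 r2 r3 : boundary X A r1 -> boundary X A r2 ->
  seg bd r1 r2 r3 -> seg bd r2 r1 r3.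
Proof.
move=> h1 h2 [h3 [deg ndeg]].
have sw : antipodal_rays X A r2 r1 \/ r2 = r1 ->
    antipodal_rays X A r1 r2 \/ r1 = r2.
  by case=> [/antipodal_sym|]; [left|right].
have sub r : boundary X A r -> r `<=` pts X.
  by move=> /boundaryE[D [_ _ ->]] E /hl_pts[].
split=> //; split=> [/sw/deg[]|nd B C hB hC]; [by right|by left|].
have nd' : ~ (antipodal_rays X A r1 r2 \/ r1 = r2).
  by case=> [/antipodal_sym ?|?]; apply: nd; [left|right].
have [D [hD sD]] := ndeg nd' C B hC hB; exists D; split=> //.
have [] // := @bt_sym C D B.
by split=> //; [apply: (sub r1)|apply: (sub r2)].
Qed.

Lemma boundary_cases r1 r2 : boundary X A r1 -> boundary X A r2 ->
  (antipodal_rays X A r1 r2 \/ r1 = r2) \/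
  exists B C, [/\ ~ col A B C, pts X B, pts X C, r1 = hl A B & r2 = hl A C].
Proof.
move=> /boundaryE[B [hB AB ->]] /boundaryE[C [hC nAC ->]].
have [/(degenerateE hB hC AB nAC)|ncol] := pselect (col A B C); first by left.
by right; exists B, C.
Qed.

(** Distinct D and E would span the line l(B,C), which would then contain A. This makes projection
    from A injective on [B,C]. *)
Lemma col_transversal B C D E : ~ col A B C -> bt B D C -> bt B E C ->
  col A D E -> D = E.
Proof.
move=> ncol hD hE; have [hB _ hC] := bt_pts hD.
have BC : B <> C.
  by move=> e; apply: ncol; rewrite e; apply/Or31/bt_r.
move=> h; apply: contrapT => DE.
have lD : ln B C D by apply/lnE/Or32/bt_sym.
have lE : ln B C E by apply/lnE/Or32/bt_sym.
apply: ncol; do 2!apply: col_rot; apply/lnE.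
by rewrite -(ln_eq hB hC BC DE lD lE); apply/lnE/col_rot.
Qed.

Lemma hl_transversal_inj B C D E : ~ col A B C -> bt B D C -> bt B E C ->
  hl A D = hl A E -> D = E.
Proof.
move=> ncol hD hE e; apply: (col_transversal ncol hD hE).
by apply/lnE/hl_ln; rewrite e; apply: hl_r => //; case: (bt_pts hE).
Qed.

Lemma hl_transversal_neq B C D : ~ col A B C -> bt B D C -> A <> D.
Proof. by move=> ncol h e; apply: ncol; rewrite e; apply/Or33/bt_sym. Qed.

Lemma boundary_subseg B C D E : ~ col A B C -> bt B D C -> bt B E C ->
  seg bd (hl A D) (hl A E) = hl A @` seg X D E.
Proof.
move=> ncol hD hE; have [_ pD _] := bt_pts hD; have [_ pE _] := bt_pts hE.
have [<-|DE] := pselect (D = E).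
  rewrite seg_id // image_set1 boundary_seg_refl //.
  by apply/boundaryE; exists D; split=> //; exact: (hl_transversal_neq ncol hD).
by apply: boundary_seg => // h; apply: DE; exact: (col_transversal ncol).
Qed.

Lemma boundary_betweenness : betweenness bd.
Proof.
split=> [r1 r2|r1 r2 r3 h1 h2 h3|r1 r2 r3 h1 h2 h3 h].
- exact: boundary_seg_l.
- exact: boundary_seg_sym.
- rewrite boundary_seg_refl //.
  have [deg|[B [C [ncol hB hC e1 e2]]]] := boundary_cases h1 h2.
    (* A degenerate segment contains only its two ends, so r3 is one of them. *)
    have [e|e] : r3 = r1 \/ r3 = r2 by case: h => _ [/(_ deg)].
      rewrite e boundary_seg_refl //; split=> //; apply/seteqP; split=> r.
      + by right.
      + by case=> // ->; exact: boundary_seg_l.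
      + by case.
      + by move=> ->; split=> //; exact: boundary_seg_l.
    rewrite e boundary_seg_refl //; split=> //; apply/seteqP; split=> r.
    + by left.
    + by case=> // ->; apply: boundary_seg_sym => //; exact: boundary_seg_l.
    + by case.
    + move=> ->; split=> //.
      by apply: boundary_seg_sym => //; exact: boundary_seg_l.
  move: h; rewrite e1 e2 boundary_seg // => -[D sD <-] {h3 r3}.
  have h : bt B D C by split.
  have hB' := bt_l hB hC; have hC' := bt_r hB hC.
  have [_ hD _] := bt_pts h.
  rewrite (boundary_subseg ncol hB' h) (boundary_subseg ncol h hC').
  have [_ _ c] := hX; have [eU eI eD] := c B C D hB hC hD sD.
  split=> //; first by rewrite eU image_setU.
  apply/seteqP; split=> r.
    (* A ray in both parts comes from a point E of [B,D] and a point F of [D,C]; injectivity gives E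
       = F, which is therefore D. *)
    move=> [[E sE <-] [F sF eF]] /=; congr (hl A _).
    have hE : bt B E C by apply: bt_widen h _; split.
    have hF : bt B F C.
      by apply/bt_sym; apply: (bt_widen (bt_sym h)); apply: bt_sym; split.
    have EF := hl_transversal_inj ncol hF hE eF.
    have : (seg X B D `&` seg X D C) E by split=> //; rewrite -EF.
    by rewrite eI eD.
  by move=> ->; split; exists D => //; [case: (bt_r hB hD)|case: (bt_l hD hC)].
Qed.

(** A split of the segment of rays is pulled back to a split of [B,C], and closed segments
    correspond under this, so connectedness of [B,C] decides which part is closed. *)
Lemma boundary_connected r1 r2 : boundary X A r1 -> boundary X A r2 ->
  r2 <> opposite r1 -> connected_segment bd (seg bd r1 r2).
Proof.
move=> h1 h2 nopp; split; first by exists r1, r2.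
have [[/antipodal_eq //|<-]|[B [C [ncol hB hC -> ->]]]] := boundary_cases h1 h2.
  by move=> P Q; rewrite boundary_seg_refl // => sp; case: (convex_split_set1 sp).
rewrite boundary_seg // => P Q [e dis [[p hp] [q hq]] [cP cQ]].
(* The preimage is cut down to [B,C], where projection from A is injective; the full preimage would
   be a union of rays. *)
pose trace R := seg X B C `&` [set D | R (hl A D)] : set T.
have traceE R D : trace R D -> bt B D C /\ R (hl A D) by case.
have trace_convex R : convex bd R -> convex X (trace R).
  move=> [_ cv]; split=> [D [[]] //|D E /traceE[hD RD] /traceE[hE RE] F sF].
  have hF : bt D F E by split=> //; [case: (bt_pts hD)|case: (bt_pts hE)].
  split; first by case: (bt_narrow hD hE hF).
  apply: (cv _ _ RD RE); rewrite (boundary_subseg ncol hD hE).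
  by exists F.
have trace_closed R : R `<=` hl A @` seg X B C -> convex bd R ->
    closed_segment X (trace R) <-> closed_segment bd R.
  move=> sR [_ cv]; split=> [[D [E [hD hE eR]]]|[r [s [hr hs eR]]]].
    have [hD' RD] : bt B D C /\ R (hl A D).
      by apply: traceE; rewrite eR; case: (bt_l hD hE).
    have [hE' RE] : bt B E C /\ R (hl A E).
      by apply: traceE; rewrite eR; case: (bt_r hD hE).
    exists (hl A D), (hl A E); split.
    + by apply/boundaryE; exists D; split=> //; exact: (hl_transversal_neq ncol hD').
    + by apply/boundaryE; exists E; split=> //; exact: (hl_transversal_neq ncol hE').
    apply/seteqP; split; last exact: cv.
    move=> r Rr; have [F sF eF] := sR r Rr.
    rewrite (boundary_subseg ncol hD' hE') -eR -eF; exists F => //.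
    by split=> //=; rewrite eF.
  have Rr : R r by rewrite eR; exact: boundary_seg_l.
  have Rs : R s by rewrite eR; apply: boundary_seg_sym => //; exact: boundary_seg_l.
  have [D sD eD] := sR r Rr; have [E sE eE] := sR s Rs.
  have hD : bt B D C by []; have hE : bt B E C by [].
  exists D, E; split; [by case: (bt_pts hD)|by case: (bt_pts hE)|].
  apply/seteqP; split=> F.
    case/traceE=> hF; rewrite eR -eD -eE (boundary_subseg ncol hD hE).
    case=> G sG eG; have hG : bt D G E.
      by split=> //; [case: (bt_pts hD)|case: (bt_pts hE)].
    by rewrite -(hl_transversal_inj ncol (bt_narrow hD hE hG) hF eG).
  move=> sF; have hF : bt D F E.
    by split=> //; [case: (bt_pts hD)|case: (bt_pts hE)].
  split; first by case: (bt_narrow hD hE hF).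
  rewrite /= eR -eD -eE (boundary_subseg ncol hD hE).
  by exists F.
have nonempty R r : R `<=` hl A @` seg X B C -> R r -> trace R !=set0.
  by move=> sR Rr; have [D sD eD] := sR r Rr; exists D; split=> //=; rewrite eD.
have sP : P `<=` hl A @` seg X B C by rewrite e; left.
have sQ : Q `<=` hl A @` seg X B C by rewrite e; right.
have [_ con] : connected_segment X (seg X B C).
  by apply: all_connected; exists B, C.
have := con (trace P) (trace Q).
rewrite !trace_closed //; apply; split.
- apply/seteqP; split=> D; last by case; case.
  move=> sD; have : (P `|` Q) (hl A D) by rewrite -e; exists D.
  by case; [left|right].
- apply/seteqP; split=> D //.
  by move=> [[_ PD] [_ QD]]; have : (P `&` Q) (hl A D) by []; rewrite dis.
- by split; [exact: (nonempty P p)|exact: (nonempty Q q)].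
- by split; exact: trace_convex.
Qed.

(** * Rays pointing into a half-plane *)

Definition half (h : set T) : set (set T) :=
  [set r | boundary X A r /\ exists2 B, r B & h B].

Lemma half_hl h B : pts X B -> A <> B -> h B -> half h (hl A B).
Proof.
move=> hB AB hhB; split; first by apply/boundaryE; exists B.
by exists B => //; exact: hl_r.
Qed.

Lemma halfE h r : ~ h A -> half h r ->
  exists B, [/\ pts X B, A <> B, h B & r = hl A B].
Proof.
move=> nA [/boundaryE[B [_ AB ->]] [C hC hhC]].
have nAC : A <> C by move=> e; apply: nA; rewrite e.
by exists C; split=> //; [case: (hl_pts hC)|rewrite (hl_eq AB nAC hC)].
Qed.

(** Antipodal rays would put A between two points of h, hence into the convex set h. *)
Lemma half_antipodal h r1 r2 : convex X h -> ~ h A -> half h r1 -> half h r2 ->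
  ~ antipodal_rays X A r1 r2.
Proof.
move=> [_ cv] nA [_ [B hB hhB]] [_ [C hC hhC]] /antipodal_eq e.
move: hC; rewrite e => -[_ /(_ B hB) [_ _ s]].
by apply: nA; apply: (cv B C).
Qed.

Lemma half_convex h : convex X h -> ~ h A -> convex bd (half h).
Proof.
move=> ch nA; split=> [r []//|r1 r2 h1 h2].
have [b1 _] := h1; have [b2 _] := h2.
have na := half_antipodal ch nA h1 h2.
have [B [hB AB hhB e1]] := halfE nA h1; have [C [hC nAC hhC e2]] := halfE nA h2.
have [e|ncol] := pselect (col A B C).
  have {}e : r1 = r2.
    by move: e => /(degenerateE hB hC AB nAC); rewrite -e1 -e2 => -[].
  by rewrite -e boundary_seg_refl // => r ->.
rewrite e1 e2 boundary_seg // => _ [D sD <-].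
have hD : bt B D C by split.
apply: half_hl; [by case: (bt_pts hD)|exact: (hl_transversal_neq ncol hD)|].
by case: ch => _ cv; apply: (cv B C).
Qed.

Definition half_planes (l h1 h2 : set T) : Prop :=
  convex_split X (pts X `\` l) h1 h2 /\
  forall C D, same_side l C D <-> (h1 C /\ h1 D) \/ (h2 C /\ h2 D).

Lemma half_planes_sym l h1 h2 : half_planes l h1 h2 -> half_planes l h2 h1.
Proof.
move=> [[e dis [? ?] [? ?]] ss]; split=> [|C D]; last by rewrite ss; tauto.
by split=> //; [rewrite setUC|rewrite setIC].
Qed.

Lemma half_planes_off l h1 h2 C : half_planes l h1 h2 ->
  h1 C -> [/\ pts X C, ~ l C & ~ h2 C].
Proof.
move=> [[e dis _ _] _] hC.
have [? ?] : (pts X `\` l) C by rewrite e; left.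
by split=> // hC'; have : (h1 `&` h2) C by []; rewrite dis.
Qed.

Lemma half_planes_mem l h1 h2 C : half_planes l h1 h2 ->
  pts X C -> ~ l C -> h1 C \/ h2 C.
Proof.
by move=> [[e _ _ _] _] hC lC; have : (pts X `\` l) C by []; rewrite e.
Qed.

Lemma half_planes_cross l h1 h2 C D E : half_planes l h1 h2 ->
  l E -> bt C E D -> h1 C -> ~ l D -> h2 D.
Proof.
move=> hp lE h hC lD; have [_ _ hD] := bt_pts h.
case: (half_planes_mem hp hD lD) => // hD'; exfalso.
have [_ ss] := hp; have /ss[_ _ /(_ E h)] : (h1 C /\ h1 D) \/ (h2 C /\ h2 D).
  by left.
by [].
Qed.

Section HalfPlanes.

Variables (B : T) (h1 h2 : set T).
Hypotheses (hB : pts X B) (AB : A <> B).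
Hypothesis hp : half_planes (ln A B) h1 h2.

Lemma half_planes_apex : ~ h1 A.
Proof. by move=> /(half_planes_off hp)[_ + _]; apply; exact: ln_l. Qed.

(** The ray leaves l(A,B) at A and does not return, by [hl_same_side]. Hence the single point asked
    for in [half] places the whole ray, apart from A, in the half-plane. *)
Lemma half_all r C : half h1 r -> r C -> A <> C -> h1 C.
Proof.
move=> /(halfE half_planes_apex)[D [hD AD hhD ->]] hC nAC.
have [_ lD h2D] := half_planes_off hp hhD.
have [_ ss] := hp.
have /ss[[]|[]] // := hl_same_side hA hB AB (ln_l hA hB) hD lD hC nAC.
Qed.

Lemma half_neq : ~ half h1 (hl A B).
Proof.
move=> h; have := half_all h (hl_r hA hB) AB.
by move=> /(half_planes_off hp)[_ + _]; apply; exact: ln_r.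
Qed.

Lemma half_disjoint r : half h1 r -> ~ half h2 r.
Proof.
move=> h [_ [C rC hC]].
have [_ lC h1C] := half_planes_off (half_planes_sym hp) hC.
by apply: h1C; apply: (half_all h) => // e; apply: lC; rewrite -e; exact: ln_l.
Qed.

End HalfPlanes.

Lemma half_split B h1 h2 : pts X B -> A <> B -> half_planes (ln A B) h1 h2 ->
  convex_split bd (boundary X A `\` [set hl A B; opposite (hl A B)])
    (half h1) (half h2).
Proof.
move=> hB AB hp; have hp' := half_planes_sym hp.
have nA1 := half_planes_apex hB hp; have nA2 := half_planes_apex hB hp'.
have [[e dis [ne1 ne2] [c1 c2]] _] := hp.
have ex h : h !=set0 -> convex X h -> ~ h A -> half h !=set0.
  move=> [C hC] [sub _] nA; exists (hl A C); apply: half_hl => //.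
    exact: sub.
  by move=> eC; apply: nA; rewrite eC.
have bB : boundary X A (hl A B) by apply/boundaryE; exists B.
have [B' [C [AB' nAC h eB eC]]] := boundary_opposite bB.
have [hB' _ hC] := bt_pts h.
(* The opposite ray also lies on l(A,B), so neither of the two removed rays enters a half-plane. *)
have lC : ln A B C.
  have lB' : ln A B B' by apply: hl_ln; rewrite eB; exact: hl_r.
  rewrite -(ln_eq hA hB AB AB' (ln_l hA hB) lB').
  by apply/lnE/Or33/bt_sym.
have sub k1 k2 r : half_planes (ln A B) k1 k2 -> half k1 r ->
    ~ [set hl A B; opposite (hl A B)] r.
  move=> kp hr [er|er].
    by apply: (half_neq hB AB kp); rewrite -er.
  have : k1 C by apply: (half_all hB AB kp hr) => //; rewrite er eC; exact: hl_r.
  by move=> /(half_planes_off kp)[].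
split.
- apply/seteqP; split=> r.
    move=> [/[dup] hr /boundaryE[D [hD AD er]] nr].
    (* A point of l(A,B) other than A spans [hl A B] or its opposite, and both were removed. *)
    have nD : ~ ln A B D.
      move=> /ln_hl[hD'|BAD]; apply: nr.
        by left; rewrite er (hl_eq AB AD hD').
      by right; rewrite (opposite_hl AB AD BAD).
    case: (half_planes_mem hp hD nD) => hhD; [left|right]; rewrite er;
      exact: half_hl.
  case=> hr; split; [by case: hr|exact: (sub h1 h2)|by case: hr|exact: (sub h2 h1)].
- apply/seteqP; split=> r // -[r1 r2].
  by apply: (half_disjoint hB AB hp r1).
- by split; exact: ex.
- by split; exact: half_convex.
Qed.

(** Each ray AS pointing into [h1] cuts the others according to the side of l(A,S) they enter. The
    parts are convex by [half_split]; that both are non-empty and that AS lies between them is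
    checked with points of [h1]. *)
Lemma half_line B h1 h2 : pts X B -> A <> B -> half_planes (ln A B) h1 h2 ->
  line (inherited bd (half h1)).
Proof.
move=> hB AB hp.
have nA := half_planes_apex hB hp.
have [[_ _ [[S0 hS0] _] [c1 _]] _] := hp.
have cH := half_convex c1 nA.
have [B' BAB' BA'] := bt_extend hB hA (nesym AB).
have AB' : A <> B' by exact: nesym.
have [_ _ hB'] := bt_pts BAB'.
have lB' : ln A B B' by apply/lnE/Or33/bt_sym.
have cut r : half h1 r -> exists d1 d2,
    convex_split (inherited bd (half h1)) (half h1 `\ r) d1 d2 /\
    forall s t, d1 s -> d2 t -> seg (inherited bd (half h1)) s t r.
  move=> hr; have [S [hS AS hhS er]] := halfE nA hr.
  have [_ lS _] := half_planes_off hp hhS.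
  have [k1 [k2 kp]] : exists k1 k2, half_planes (ln A S) k1 k2.
    exact: ln_sides.
  have kp' := half_planes_sym kp.
  have [eK disK _ [cK1 cK2]] := half_split hS AS kp.
  have lAS E : ln A B E -> ln A S E -> A = E.
    move=> l1 l2; apply: contrapT => AE; apply: lS.
    rewrite -(ln_eq hA hB AB AE (ln_l hA hB) l1).
    rewrite (ln_eq hA hS AS AE (ln_l hA hS) l2).
    exact: ln_r.
  have nB : ~ ln A S B by move=> /(lAS B (ln_r hA hB)).
  have nB' : ~ ln A S B' by move=> /(lAS B' lB').
  (* Prolonging [D,S] beyond S crosses l(A,S) while staying on the same side
     of l(A,B) as S. *)
  have beyond D m1 m2 : half_planes (ln A S) m1 m2 -> ln A B D -> m1 D ->
      (half h1 `&` half m2) !=set0.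
    move=> mp lD mD; have [hD nD _] := half_planes_off mp mD.
    have DS : D <> S by move=> e; apply: nD; rewrite e; exact: ln_r.
    have [C DSC CS] := bt_extend hD hS DS.
    have [_ _ hC] := bt_pts DSC.
    have DC : D <> C.
      by move=> e; move: DSC; rewrite -e => /bt_id /esym.
    have nC : ~ ln A S C.
      move=> lC; apply: nD; rewrite -(ln_eq hA hS AS (nesym CS) (ln_r hA hS) lC).
      by apply/lnE/Or33.
    have AC' : A <> C by move=> e; apply: nC; rewrite -e; exact: ln_l.
    have m2C : m2 C by apply: (half_planes_cross mp (ln_r hA hS) DSC).
    have h1C : h1 C.
      have [_ ss] := hp.
      have hDC : hl D S C by right.
      have /ss[[]|[h2S _]] // := hl_same_side hA hB AB lD hS lS hDC DC.
      by have [_ _] := half_planes_off hp hhS.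
    by exists (hl A C); split; exact: half_hl.
  (* The points B and B' lie on l(A,B) on different sides of A, hence on different sides of l(A,S);
     [beyond] applied to each of them gives a ray in the opposite part. *)
  have ne : (half h1 `&` half k1) !=set0 /\ (half h1 `&` half k2) !=set0.
    case: (half_planes_mem kp hB nB) => kB.
      have kB' := half_planes_cross kp (ln_l hA hS) BAB' kB nB'.
      by split; [exact: (beyond B' k2 k1)|exact: (beyond B k1 k2 kp (ln_r hA hB))].
    have kB' := half_planes_cross kp' (ln_l hA hS) BAB' kB nB'.
    by split; [exact: (beyond B k2 k1 kp' (ln_r hA hB))|exact: (beyond B' k1 k2)].
  exists (half h1 `&` half k1), (half h1 `&` half k2); split.
    split=> //.
    - apply/seteqP; split=> s.
        move=> [hs sr].
        have : (boundary X A `\` [set hl A S; opposite (hl A S)]) s.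
          split; first by case: hs.
          case=> es; first by apply: sr; rewrite er.
          apply: (half_antipodal c1 nA hr hs); rewrite es -er.
          by apply: antipodal_opposite; case: hr.
        by rewrite eK => -[]; [left|right].
      have sub : (half k1 `|` half k2) s -> half h1 s -> (half h1 `\ r) s.
        rewrite -eK => -[_ ns] hs; split=> // es.
        by apply: ns; left; rewrite -er.
      by case=> -[hs ks]; apply: sub => //; [left|right].
    - apply/seteqP; split=> s //; move=> [[_ s1] [_ s2]].
      by have : (half k1 `&` half k2) s by []; rewrite disK.
    - have cv k : convex bd (half k) ->
          convex (inherited bd (half h1)) (half h1 `&` half k).
        move=> [_ ck]; split=> [s []//|s t [hs ks] [ht kt] u].
        rewrite inherited_seg // => hu; split; last exact: (ck s t).
        by case: cH => _; apply; [exact: hs|exact: ht|].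
      by split; exact: cv.
  move=> s t [hs ks] [ht kt]; rewrite inherited_seg //.
  have [U [hU AU kU es]] := halfE (half_planes_apex hS kp) ks.
  have [V [hV AV kV et]] := halfE (half_planes_apex hS kp') kt.
  have hhU : h1 U by apply: (half_all hB AB hp hs) => //; rewrite es; exact: hl_r.
  have hhV : h1 V by apply: (half_all hB AB hp ht) => //; rewrite et; exact: hl_r.
  (* Collinearity would make the rays antipodal, impossible within [h1], or equal, impossible as
     they enter different sides of l(A,S). *)
  have ncol : ~ col A U V.
    move=> /(degenerateE hU hV AU AV); rewrite -es -et => -[].
      exact: (half_antipodal c1 nA hs ht).
    by move=> est; apply: (half_disjoint hS AS kp ks); rewrite est.
  have [P lP UPV] : exists2 P, ln A S P & bt U P V.
    apply: same_side_ln => //; have [_ ss] := kp.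
    move=> /ss[[_ k1V]|[k2U _]].
      by have [_ _] := half_planes_off kp k1V.
    by have [_ _] := half_planes_off kp kU.
  have hhP : h1 P by case: c1 => _ cv; apply: (cv U V) => //; case: UPV.
  have AP : A <> P by move=> e; apply: nA; rewrite e.
  (* If P were behind A on l(A,S), then A would be between S and P, two points of the convex set
     [h1]. *)
  have hP' : hl A S P.
    case: (ln_hl lP) => // -[_ _ sA]; exfalso.
    by apply: nA; case: c1 => _ cv; apply: (cv S P).
  rewrite es et boundary_seg // er; exists P; first by case: UPV.
  by rewrite (hl_eq AS AP hP').
have [hS0p _ _] := half_planes_off hp hS0.
have AS0 : A <> S0 by move=> e; apply: nA; rewrite e.
have hr := half_hl hS0p AS0 hS0.
split; [exact: inherited_betweenness boundary_betweenness cH| |exact: cut].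
(* Cutting at one ray leaves a non-empty part, which supplies the second element of the line. *)
have [d1 [d2 [[e _ [[s ds] _] _] _]]] := cut _ hr.
have [hs /= ns] : (half h1 `\ hl A S0) s by rewrite e; left.
by exists s, (hl A S0).
Qed.

(** * The circle at infinity and the theorem *)

Lemma boundary_circle : circle bd.
Proof.
have [_ [B1 [B2 [hB1 hB2 B12]]] _] := hP.
have [B [hB AB]] : exists B, pts X B /\ A <> B.
  have [e|] := pselect (A = B1); last by exists B1.
  by exists B2; split=> //; rewrite e.
have bopp r : boundary X A r -> boundary X A (opposite r).
  by move=> /antipodal_opposite /antipodal_sym /antipodal_boundary.
split; first exact: boundary_betweenness.
- have [h1 [h2 hp]] : exists h1 h2, half_planes (ln A B) h1 h2.
    exact: ln_sides.
  (* The third point of the circle is any ray into one of the half-planes of l(A,B). *)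
  have [e _ [[r hr] _] _] := half_split hB AB hp.
  have [br nr] : (boundary X A `\` [set hl A B; opposite (hl A B)]) r.
    by rewrite e; left.
  have bB : boundary X A (hl A B) by apply/boundaryE; exists B.
  exists (hl A B), (opposite (hl A B)), r; split; split=> //.
  + exact: bopp.
  + exact/antipodal_neq/antipodal_opposite.
  + by move=> er; apply: nr; left.
  + by move=> er; apply: nr; right.
- exists opposite; split=> [r hr|r1 r2|r /boundaryE[C [hC nAC ->]]].
  + split; first exact: bopp.
    exists r, (opposite r); split; first exact/antipodal_neq/antipodal_opposite.
    apply: boundary_seg_degenerate; [by []|exact: bopp|left].
    exact: antipodal_opposite.
  + exact: boundary_connected.
  + have [h1 [h2 hp]] : exists h1 h2, half_planes (ln A C) h1 h2.
      exact: ln_sides.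
    exists (half h1), (half h2); split; first exact: half_split.
      exact: (half_line hC nAC hp).
    exact: (half_line hC nAC (half_planes_sym hp)).
Qed.

End Plane.

Theorem theorem17p10 (T : Type) (Pi : bspace T) (hPi : plane Pi) :
  pasch_space Pi /\
  (forall A : T, pts Pi A -> circle (boundary_space Pi A)).
Proof.
have hM : maximal_ray_space Pi by case: hPi.
have hb : betweenness Pi by case: hM.
split; last by move=> A hA; exact: boundary_circle.
split=> // A hA r1 r2 r3 sub dis B C D.
have b r : [set r1; r2; r3]%classic r -> boundary Pi A r by exact: sub.
apply: (pasch_at hb hPi hA).
- by apply: b; do 2 left.
- by apply: b; left; right.
- by apply: b; right.
(* If r1 and r3 were antipodal, r3 would lie in the intersection assumed to be empty. *)
move=> anti.
have : ([set r1; r2; r3] `&` antipodal_set Pi A [set r1; r2; r3])%classic r3.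
  by split; [right|exists r1 => //; do 2 left].
by rewrite dis.
Qed.
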